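(* For all integers $a \geq 2$ and $n \geq 2$, we have $G_{n,a} \equiv 1 - \frac{n}{2} a \pmod{a}$.
   Context: For an integer $a \geq 2$, the generalized Genocchi numbers $G_{n,a}$ ($n \geq 0$) are defined by $$\frac{a t}{e^{(a-1)t} + e^{(a-2)t} + \dots + e^t + 1} = \sum_{n=0}^{\infty} G_{n,a} \frac{t^n}{n!}.$$ Congruences are extended to rationals: for $x, y \in \mathbb{Q}$ and a positive integer $m$, $x \equiv y \pmod{m}$ means that the numerator of the reduced fraction $x - y$ is a multiple of $m$ (equivalently, $\vartheta_p(x-y) \geq \vartheta_p(m)$ for every prime $p \mid m$, where $\vartheta_p$ is the $p$-adic valuation). *)

(* Defs.v *)
(* Formal power series over rat are represented by their coefficient
   sequences nat -> rat. *)
From HB Require Import structures.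
From mathcomp Require Import all_boot all_order all_algebra.
Set Implicit Arguments.
Unset Strict Implicit.
Unset Printing Implicit Defensive.
Import Order.TTheory GRing.Theory Num.Theory.
Local Open Scope ring_scope.

Definition fps := nat -> rat.

Definition fps_one : fps := fun n => (n == 0%N)%:R.

Definition fps_mul (f g : fps) : fps :=
  fun n => \sum_(i < n.+1) f i * g (n - i)%N.

(* [:: g 0; ...; g n.-1] for the g with g * f = 1, each coefficient being
   solved for in terms of the previous ones. *)
Fixpoint fps_inv_seq (f : fps) (n : nat) : seq rat :=
  if n is m.+1 then
    let s := fps_inv_seq f m in
    rcons s ((fps_one m - \sum_(i < m) s`_i * f (m - i)%N) / f 0%N)
  else [::].

(* Meaningful only when f 0 != 0; see fps_mulVf. *)
Definition fps_inv (f : fps) : fps := fun n => (fps_inv_seq f n.+1)`_n.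

Definition fps_div (f g : fps) : fps := fps_mul f (fps_inv g).

(* c * t *)
Definition fps_linear (c : rat) : fps := fun n => if n == 1%N then c else 0.

(* e^(c t) *)
Definition fps_exp (c : rat) : fps := fun n => c ^+ n / n`!%:R.

(* e^((a-1)t) + ... + e^t + 1 *)
Definition genocchi_den (a : nat) : fps :=
  fun n => \sum_(j < a) fps_exp j%:R n.

Definition genocchi_gf (a : nat) : fps :=
  fps_div (fps_linear a%:R) (genocchi_den a).

Definition genocchi (a n : nat) : rat := genocchi_gf a n * n`!%:R.

(* numq is the numerator of the reduced fraction. *)
Definition ratcong (m : nat) (x y : rat) : Prop := (m%:Z %| numq (x - y))%Z.

Lemma size_fps_inv_seq f n : size (fps_inv_seq f n) = n.
Proof. by elim: n => //= n IHn; rewrite size_rcons IHn. Qed.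

Lemma nth_fps_inv_seq f n i : (i < n)%N -> (fps_inv_seq f n)`_i = fps_inv f i.
Proof.
elim: n => // n IHn; rewrite ltnS leq_eqVlt => /predU1P[-> //|lt_in].
by rewrite /= nth_rcons size_fps_inv_seq lt_in IHn.
Qed.

Lemma fps_mulVf f : f 0%N != 0 -> fps_mul (fps_inv f) f =1 fps_one.
Proof.
move=> f0 n; rewrite /fps_mul big_ord_recr /= subnn.
rewrite {2}/fps_inv /= nth_rcons size_fps_inv_seq ltnn eqxx divfK //.
under [X in _ + (_ - X)]eq_bigr => i _ do rewrite nth_fps_inv_seq //.
by rewrite addrC subrK.
Qed.

Lemma fps_mulC f g : fps_mul f g =1 fps_mul g f.
Proof.
move=> n; rewrite /fps_mul (reindex_inj rev_ord_inj) /=.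
by apply: eq_bigr => i _; rewrite subSS subKn ?leq_ord // mulrC.
Qed.

Lemma genocchi_den0 a : genocchi_den a 0%N = a%:R.
Proof.
rewrite /genocchi_den (eq_bigr (fun=> 1)) => [|i _];
  first by rewrite sumr_const card_ord.
by rewrite /fps_exp expr0 divr1.
Qed.

Lemma fps_linear_mulS c f n : fps_mul (fps_linear c) f n.+1 = c * f n.
Proof.
rewrite /fps_mul 2!big_ord_recl /= /fps_linear /= mul0r add0r subSS subn0.
by rewrite big1 ?addr0 // => i _; rewrite mul0r.
Qed.

Lemma fps_linear_mul0 c f : fps_mul (fps_linear c) f 0%N = 0.
Proof. by rewrite /fps_mul big_ord1 mul0r. Qed.

(* The defining identity:
   (e^((a-1)t) + ... + 1) * \sum_n genocchi a n * t^n / n! = a t. *)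
Lemma genocchi_gfE a : (0 < a)%N ->
  fps_mul (genocchi_den a) (fun n => genocchi a n / n`!%:R)
  =1 fps_linear a%:R.
Proof.
move=> a0.
have d0 : genocchi_den a 0%N != 0 by rewrite genocchi_den0 pnatr_eq0 -lt0n.
have E n : genocchi a n / n`!%:R = genocchi_gf a n.
  by rewrite mulfK // pnatr_eq0 -lt0n fact_gt0.
case=> [|n]; first by rewrite /fps_mul big_ord1 E /genocchi_gf /fps_div
  fps_linear_mul0 mulr0.
rewrite /fps_mul big_ord_recr /= subnn E /genocchi_gf /fps_div
  fps_linear_mul0 mulr0 addr0.
transitivity (a%:R * fps_mul (genocchi_den a) (fps_inv (genocchi_den a)) n).
  rewrite /fps_mul mulr_sumr; apply: eq_bigr => i _; rewrite E.
  by rewrite /genocchi_gf /fps_div subSn ?leq_ord // fps_linear_mulS mulrCA.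
rewrite fps_mulC fps_mulVf // /fps_one /fps_linear eqSS.
by case: (n == 0%N); rewrite ?mulr1 ?mulr0.
Qed.

(* Main.v *)
(** Multiplying the defining identity by [e^t - 1] turns it into
    [G(t) (e^(at) - 1) = a t (e^t - 1)], that is, for [n >= 1],
    [G_n = 1 - \sum_(1 <= j <= n) 'C(n, j) (a^j / (j + 1)) G_(n - j)].
    Call a rational [a]-integral if its denominator is prime to [a]. Since
    [v_p(j + 1) <= j], and [v_p(j + 1) <= j - 1] when [j >= 2], the number
    [a^j / (j + 1)] is [a]-integral, and is [a] times an [a]-integral number
    when [j >= 2]. Hence every [G_n] is [a]-integral and
    [G_n = 1 - n (a / 2) G_(n-1)] modulo [a]; substituting this relation for
    [G_(n-1)] into the one for [G_n] leaves the error term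
    ['C(n, 2) a (a / 2) G_(n-2)], which vanishes modulo [a]. *)
Require Import Defs.
From mathcomp Require Import all_boot all_order all_algebra.
From mathcomp Require Import ring.
Import Order.TTheory GRing.Theory Num.Theory.
Local Open Scope ring_scope.

Lemma eq_fps_mul f f' g g' :
  f =1 f' -> g =1 g' -> fps_mul f g =1 fps_mul f' g'.
Proof. by move=> ef eg n; apply: eq_bigr => i _; rewrite ef eg. Qed.

(** The coefficient of index [n] only involves indices up to [n], so truncation is harmless;
    associativity is thereby inherited from the polynomial ring. *)
Lemma fps_mul_coefM f g N n : (n < N)%N ->
  fps_mul f g n = ((\poly_(i < N) f i) * (\poly_(i < N) g i))`_n.
Proof.
move=> lt_nN; rewrite coefM; apply: eq_bigr => i _; rewrite !coef_poly.
rewrite (leq_ltn_trans (leq_subr _ _) lt_nN).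
by rewrite (leq_ltn_trans _ lt_nN) // -ltnS.
Qed.

Lemma fps_mulA f g h :
  fps_mul f (fps_mul g h) =1 fps_mul (fps_mul f g) h.
Proof.
move=> n; pose P f := \poly_(i < n.+1) f i : {poly rat}.
transitivity ((P f * (P g * P h))`_n).
  rewrite coefM; apply: eq_bigr => i _.
  by rewrite coef_poly ltn_ord (fps_mul_coefM _ _ n.+1) // ltnS leq_subr.
rewrite mulrA coefM; apply: eq_bigr => i _.
by rewrite [(P h)`__]coef_poly ltnS leq_subr (fps_mul_coefM _ _ n.+1).
Qed.

Lemma fps_expD x y : fps_mul (fps_exp x) (fps_exp y) =1 fps_exp (x + y).
Proof.
move=> n; rewrite /fps_exp addrC exprDn mulr_suml; apply: eq_bigr => i _.
have le_in : (i <= n)%N by rewrite -ltnS.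
have nz k : k`!%:R != 0 :> rat by rewrite pnatr_eq0 -lt0n fact_gt0.
have /(congr1 (fun k => k%:R : rat)) := bin_fact le_in.
rewrite !natrM -mulr_natr => <-.
have bnz : 'C(n, i)%:R != 0 :> rat by rewrite pnatr_eq0 -lt0n bin_gt0.
by field; rewrite !nz bnz.
Qed.

Lemma fps_exp0 : fps_exp 0 =1 fps_one.
Proof. by case=> [|n]; rewrite /fps_exp /fps_one ?expr0n ?mul0r. Qed.

Definition fps_expm1 (c : rat) : fps := fun n => fps_exp c n - fps_one n.

(** Geometric sum: each product [(e^t - 1) e^(jt)] is [e^((j+1)t) - e^(jt)], and the sum over
    [j < a] telescopes. *)
Lemma fps_expm1_genocchi_den a :
  fps_mul (fps_expm1 1) (genocchi_den a) =1 fps_expm1 a%:R.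
Proof.
move=> n; rewrite /fps_mul /genocchi_den.
under eq_bigr => i _ do rewrite mulr_sumr.
rewrite exchange_big /=.
rewrite (eq_bigr (fun j : 'I_a => fps_exp j.+1%:R n - fps_exp j%:R n)).
  rewrite -(big_mkord xpredT (fun j => fps_exp j.+1%:R n - fps_exp j%:R n)).
  by rewrite telescope_sumr // fps_exp0.
move=> j _; under eq_bigr => i _ do rewrite mulrBl.
rewrite sumrB; congr (_ - _); first by rewrite -[j.+1%:R]nat1r -fps_expD.
rewrite -[RHS](congr1 (fps_exp^~ n) (add0r j%:R)) -fps_expD.
by apply: eq_bigr => i _; rewrite fps_exp0.
Qed.

Lemma genocchi_fps_expm1 a : (0 < a)%N ->
  fps_mul (fps_expm1 a%:R) (fun n => genocchi a n / n`!%:R)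
  =1 fps_mul (fps_linear a%:R) (fps_expm1 1).
Proof.
move=> a0 n; rewrite [RHS]fps_mulC.
rewrite -(eq_fps_mul _ _ _ _ (frefl _) (genocchi_gfE a0)) fps_mulA.
by apply: eq_fps_mul => // i; rewrite fps_expm1_genocchi_den.
Qed.

Lemma genocchi0 a : genocchi a 0 = 0.
Proof. by rewrite /genocchi /genocchi_gf /fps_div fps_linear_mul0 mul0r. Qed.

Lemma genocchi_sum a n : (0 < a)%N -> (0 < n)%N ->
  \sum_(j < n.+1)
    'C(n, j)%:R * (a%:R ^+ j / j.+1%:R) * genocchi a (n - j) = 1.
Proof.
move=> a0 n0.
have nz k : k`!%:R != 0 :> rat by rewrite pnatr_eq0 -lt0n fact_gt0.
have anz : a%:R != 0 :> rat by rewrite pnatr_eq0 -lt0n.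
have := genocchi_fps_expm1 a a0 n.+1; rewrite fps_linear_mulS.
rewrite /fps_mul big_ord_recl /fps_expm1 /fps_one [fps_exp _ ord0]/fps_exp /=.
rewrite expr0 divr1 subrr mul0r add0r => E.
(* Coefficients of [t^(n+1)] are compared, since [e^(at) - 1] has no constant term and the right
   side carries a factor [t]; scaling by [n! / a] turns the factorials into ['C(n, j) / (j + 1)]. *)
transitivity (n`!%:R / a%:R * (a%:R * (fps_exp 1 n - (n == 0%N)%:R)) : rat);
  last by rewrite gtn_eqF // subr0 /fps_exp expr1n; field; rewrite anz nz.
rewrite -E mulr_sumr; apply: eq_bigr => i _.
have le_in : (i <= n)%N by rewrite -ltnS.
rewrite [bump 0 i]add1n subSS subr0 /fps_exp factS exprS.
have /(congr1 (fun k => k%:R : rat)) := bin_fact le_in.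
rewrite !natrM => <-.
by field; rewrite anz !nz nat1r pnatr_eq0.
Qed.

Lemma genocchi_rec a n : (0 < a)%N ->
  genocchi a n.+1 = 1 - \sum_(j < n.+1)
    'C(n.+1, j.+1)%:R * (a%:R ^+ j.+1 / j.+2%:R) * genocchi a (n - j).
Proof.
move=> a0; have := genocchi_sum a n.+1 a0 isT; rewrite big_ord_recl.
by move/(canRL (addrK _)); rewrite bin0 expr0 divr1 !mul1r subn0.
Qed.

(** Any cleared denominator [d] is accepted, not just the reduced one, so that sums and products
    simply multiply their witnesses. *)
Definition int_at (a : nat) (x : rat) : Prop :=
  exists2 d : nat, coprime a d & x * d%:R \is a Num.int.

Section IntAt.
Variable a : nat.

Lemma int_at_int x : x \is a Num.int -> int_at a x.
Proof. by exists 1%N; rewrite ?coprimen1 ?mulr1. Qed.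

Lemma int_at_nat n : int_at a n%:R.
Proof. by apply: int_at_int; rewrite rpred_nat. Qed.

Lemma int_atD x y : int_at a x -> int_at a y -> int_at a (x + y).
Proof.
move=> [d ad xd] [e ae ye]; exists (d * e)%N; first by rewrite coprimeMr ad.
have -> : (x + y) * (d * e)%:R = x * d%:R * e%:R + y * e%:R * d%:R.
  by rewrite natrM; ring.
by rewrite rpredD // rpredM // rpred_nat.
Qed.

Lemma int_atM x y : int_at a x -> int_at a y -> int_at a (x * y).
Proof.
move=> [d ad xd] [e ae ye]; exists (d * e)%N; first by rewrite coprimeMr ad.
by rewrite natrM mulrACA rpredM.
Qed.

Lemma int_atN x : int_at a x -> int_at a (- x).
Proof. by move=> [d ad xd]; exists d; rewrite // mulNr rpredN. Qed.

Lemma int_at_sum n (F : 'I_n -> rat) :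
  (forall i, int_at a (F i)) -> int_at a (\sum_i F i).
Proof.
by move=> H; apply: (big_ind (int_at a) (int_at_nat 0)) => //; apply: int_atD.
Qed.

(** Clearing denominators shows that [a] divides [numq (x - y) * d] with [d] prime to [a]; Gauss's
    lemma removes [d]. *)
Lemma ratcong_int_at x y r : int_at a r -> x - y = a%:R * r -> ratcong a x y.
Proof.
move=> [d ad /intrP[z rd]] E; rewrite /ratcong.
have /eqP : (numq (x - y) * d)%:~R = (a%:Z * z * denq (x - y))%:~R :> rat.
  rewrite !intrM numqE -rd E /= -!pmulrn; ring.
rewrite eqr_int => /eqP Ez.
by rewrite -(@Gauss_dvdzl _ _ d) // Ez -mulrA dvdz_mulr.
Qed.

(** For a prime [p] dividing [a] and [k], the [p]-part of [k] is at most [k < 2 ^ n.+1 <= p ^ n.+1],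
    so it divides [p ^ n], hence [a ^ n]. *)
Lemma partn_dvd_expn k n : (0 < k)%N -> (k < 2 ^ n.+1)%N ->
  (k`_(\pi(a)) %| a ^ n)%N.
Proof.
move=> k0 kn; apply/dvdn_partP => [|p]; first exact: part_gt0.
rewrite pi_of_part // => /andP[]; rewrite !inE => pk pa.
have pp : prime p by move: pk; rewrite mem_primes => /and3P[].
rewrite partn_part ?p_part; last by move=> q /eqP ->.
apply: (@dvdn_trans (p ^ n)%N); last first.
  by apply: dvdn_exp2r; move: pa; rewrite mem_primes => /and3P[].
apply: dvdn_exp2l; rewrite -ltnS -(ltn_exp2l _ _ (prime_gt1 pp)).
apply: leq_ltn_trans (dvdn_leq k0 (pfactor_dvdnn p k)) (leq_trans kn _).
by rewrite leq_exp2r // prime_gt1.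
Qed.

Lemma int_at_exprV k n : (0 < a)%N -> (0 < k)%N -> (k < 2 ^ n.+1)%N ->
  int_at a (a%:R ^+ n / k%:R).
Proof.
(* The witness is the part of [k] prime to [a]; the complementary part cancels against [a ^ n]. *)
move=> a0 k0 kn; exists (k`_(\pi(a)^'))%N.
  exact: pnat_coprime (pnat_pi a0) (part_pnat _ _).
have /dvdnP[q aq] := partn_dvd_expn k n k0 kn.
have -> : a%:R ^+ n / k%:R * (k`_(\pi(a)^'))%N%:R = q%:R :> rat.
  rewrite -natrX aq -{2}(partnC \pi(a) k0) !natrM.
  by field; rewrite !pnatr_eq0 -!lt0n !part_gt0.
exact: rpred_nat.
Qed.

End IntAt.

Lemma int_at_half a : (0 < a)%N -> int_at a (a%:R / 2%:R).
Proof. by move=> a0; apply: (int_at_exprV a 2 1). Qed.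

Lemma genocchi_int_at a n : (0 < a)%N -> int_at a (genocchi a n).
Proof.
move=> a0; elim/ltn_ind: n => -[|n] IH.
  by rewrite genocchi0; apply: (int_at_nat a 0).
rewrite genocchi_rec //; apply: int_atD; first exact: (int_at_nat a 1).
apply/int_atN/int_at_sum => j.
apply: int_atM; last by apply: IH; rewrite ltnS leq_subr.
apply: int_atM; first exact: int_at_nat.
by apply: int_at_exprV => //; apply: ltn_expl.
Qed.

Lemma genocchi_rec_mod a n : (0 < a)%N ->
  exists2 r, int_at a r &
    genocchi a n.+1 = 1 - n.+1%:R * (a%:R / 2%:R) * genocchi a n + a%:R * r.
Proof.
move=> a0; pose F (j : 'I_n) :=
  'C(n.+1, j.+2)%:R * (a%:R ^+ j.+1 / j.+3%:R) * genocchi a (n - j.+1) : rat.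
exists (- \sum_j F j).
  apply/int_atN/int_at_sum => j; apply: int_atM; last exact: genocchi_int_at.
  apply: int_atM; first exact: int_at_nat.
  apply: int_at_exprV => //; case: j => j _ /=.
  (* One power of [a] has been factored out, so the bound needed is [j.+3 < 2 ^ j.+2], by induction
     from [3 < 4]. *)
  by elim: j => // j IH; rewrite expnS mul2n -addnn -addn1 leq_add ?expn_gt0.
rewrite genocchi_rec // big_ord_recl /= bin1 expr1 subn0 opprD addrA.
rewrite mulrN mulr_sumr; congr (_ - _); apply: eq_bigr => j _.
rewrite /F /= /bump /= !add1n exprS; ring.
Qed.

Theorem theorem2p3 (a n : nat) (ha : (2 <= a)%N) (hn : (2 <= n)%N) :
  ratcong a (genocchi a n) (1 - n%:R / 2%:R * a%:R).
Proof.
have a0 : (0 < a)%N by apply: ltnW.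
case: n hn => [|[|n]] // _.
have [r ra Er] := genocchi_rec_mod a n.+1 a0.
have [s sa Es] := genocchi_rec_mod a n a0.
have ah := int_at_half a a0.
(* This is the error after substituting [Es] into [Er], divided by [a]; the binomial absorbs one of
   the two halves in [(n+2)(n+1)(a/2)^2]. *)
apply: (ratcong_int_at a _ _ ('C(n.+2, 2)%:R * (a%:R / 2%:R) * genocchi a n
  - n.+2%:R * (a%:R / 2%:R) * s + r)).
  apply: int_atD => //; apply: int_atD.
    apply: int_atM (genocchi_int_at a n a0).
    exact: int_atM (int_at_nat _ _) ah.
  by apply/int_atN/int_atM => //; apply: int_atM (int_at_nat _ _) _.
have -> : 'C(n.+2, 2)%:R = n.+2%:R * n.+1%:R / 2%:R :> rat.
  have := mul_bin_diag n.+2 1; rewrite bin1 -natrM => ->.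
  by rewrite natrM mulrC mulKf.
by rewrite Er Es; field.
Qed.
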